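(* Let $G = (V,E)$ be a finite simple graph, let $\beta : E \to [0,\infty]$, and let $\lambda(e) = \tanh \beta(e) \in [0,1]$ for each $e \in E$ (with $\tanh \infty = 1$). Let $Y \sim \pi_{\mathrm{subs}}(\cdot;\lambda)$, the subgraphs distribution with parameter $\lambda$. Let $\Lambda \in \{0,1\}^E$ be the random output of the algorithm ''Reduce edge weights'' (described in the context) with input $(\lambda, Y)$. For each $e\in E$ let $p(e) = 1 - \exp(-2\beta(e)) = 2\lambda(e)/(1+\lambda(e))$ (with $\exp(-\infty) = 0$). Then for every $z \in \{0,1\}^E$, $$\mathbb{P}(\Lambda = z) = \frac{1}{Z_{\mathrm{rc}}} \left[ \prod_{e : z(e) = 1} p(e) \right] \left[ \prod_{e : z(e) = 0} (1 - p(e)) \right] 2^{\#\mathcal{C}(z)},$$ where $$Z_{\mathrm{rc}} = Z_{\mathrm{subs}}\, 2^{\#V - \#E} \prod_{e \in E} \left(1 + \exp(-2\beta(e))\right).$$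
   Context: Subgraphs model: for $y \in \{0,1\}^E$ (viewed as the set of edges $e$ with $y(e)=1$) and a node $i \in V$, let $\deg(i,y) = \sum_{j \ne i,\ \{i,j\} \in E} y(\{i,j\})$. The subgraphs weight of $y$ with parameter $\lambda$ is $$w_{\mathrm{subs}}(y;\lambda) = \left[ \prod_{e : y(e) = 1} \lambda(e) \right] \left[ \prod_{i \in V} \mathbf{1}(\deg(i,y) \text{ is even}) \right],$$ where $\mathbf{1}(\cdot)$ is the indicator function. Set $Z_{\mathrm{subs}} = \sum_{y \in \{0,1\}^E} w_{\mathrm{subs}}(y;\lambda)$ and $\pi_{\mathrm{subs}}(y;\lambda) = w_{\mathrm{subs}}(y;\lambda)/Z_{\mathrm{subs}}$. Clusters: for $z \in \{0,1\}^E$, $\mathcal{C}(z)$ is the set of clusters of $z$, i.e. the set of connected components (isolated nodes included) of the graph $(V, \{e \in E : z(e) = 1\})$, and $\#\mathcal{C}(z)$ is their number. Algorithm ''Reduce edge weights'': input $\lambda : E \to [0,1]$ and $Y \in \{0,1\}^E$ with $Y \sim \pi_{\mathrm{subs}}(\cdot;\lambda)$. For each edge $e$ with $\lambda(e) \in (0,1)$, replace $\lambda(e)$ by a draw from the Bernoulli distribution with parameter $\lambda(e) + (1-\lambda(e))Y(e)$ (where $\lambda(e)$ in the parameter is the input value), the draws being independent over edges conditionally on $Y$. Edges with $\lambda(e) \in \{0,1\}$ keep their value. The output is the resulting vector in $\{0,1\}^E$. $\#S$ denotes the cardinality of a set $S$. Empty products equal $1$. *)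

(* Defs.v *)
(* MathComp / MathComp-Analysis. *)
From HB Require Import structures.
From mathcomp Require Import all_boot all_order all_algebra.
From mathcomp Require Import all_classical all_reals all_analysis.

Set Implicit Arguments.
Unset Strict Implicit.
Unset Printing Implicit Defensive.

Import Order.TTheory GRing.Theory Num.Theory.

Local Open Scope classical_set_scope.
Local Open Scope ring_scope.

(* A simple graph on V is given by a symmetric irreflexive adj : rel V; its
   edges are the two-element sets {i, j} with adj i j.  Symmetry and
   irreflexivity are assumed where they are used. *)
Definition edge (V : finType) (adj : rel V) : finType :=
  {A : {set V} | A \in [set [set u.1; u.2] | u : V * V & adj u.1 u.2]%SET}.

Definition config (V : finType) (adj : rel V) := {ffun edge adj -> bool}.

(* {i, j} is an edge e of the graph and y e = 1. *)
Definition open_edge (V : finType) (adj : rel V) (y : config adj) : rel V :=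
  [rel i j | [exists e : edge adj, (val e == [set i; j]%SET) && y e]].

Definition deg (V : finType) (adj : rel V) (i : V) (y : config adj) : nat :=
  (\sum_(j | (j != i) && adj i j) open_edge y i j)%N.

Definition w_subs (R : realType) (V : finType) (adj : rel V)
    (lam : edge adj -> R) (y : config adj) : R :=
  (\prod_(e | y e) lam e) * \prod_(i : V) (~~ odd (deg i y))%:R.

Definition Z_subs (R : realType) (V : finType) (adj : rel V)
    (lam : edge adj -> R) : R :=
  \sum_(y : config adj) w_subs lam y.

Definition pi_subs (R : realType) (V : finType) (adj : rel V)
    (lam : edge adj -> R) (y : config adj) : R :=
  w_subs lam y / Z_subs lam.

Definition clusters (V : finType) (adj : rel V) (z : config adj) :
    {set {set V}} :=
  equivalence_partition (connect (open_edge z)) [set: V]%SET.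

Definition tanh (R : realType) (x : R) : R :=
  (expR x - expR (- x)) / (expR x + expR (- x)).

Definition tanhe (R : realType) (x : \bar R) : R :=
  match x with
  | r%:E => tanh r
  | +oo%E => 1
  | -oo%E => -1
  end.

(* exp(-2b); its value at b = +oo is 0 since expeR -oo = 0. *)
Definition expN2 (R : realType) (b : \bar R) : R := fine (expeR (- (2%:E * b))%E).

(* Since config adj is finite, this is measurability for its discrete
   sigma-algebra. *)
Definition random_config (d : measure_display) (T : measurableType d)
    (V : finType) (adj : rel V) (X : T -> config adj) : Prop :=
  forall x : config adj, measurable (X @^-1` [set x]).

(* Only meaningful when P B > 0. *)
Definition cprob (R : realType) (d : measure_display) (T : measurableType d)
    (P : probability T R) (A B : set T) : R :=
  fine (P (A `&` B)) / fine (P B).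

(* Lam is an output of the algorithm on the input (lam, Y): edges with weight
   in {0, 1} keep their value; conditionally on Y, every other edge is redrawn
   from a Bernoulli distribution, independently over these edges. *)
Record reduce_edge_weights (R : realType) (d : measure_display)
    (T : measurableType d) (P : probability T R) (V : finType) (adj : rel V)
    (lam : edge adj -> R) (Y Lam : T -> config adj) : Prop :=
  ReduceEdgeWeights {
    reduce_measurable : random_config Lam ;
    reduce_keep : forall (t : T) (e : edge adj),
      lam e = 0 \/ lam e = 1 -> (Lam t e)%:R = lam e ;
    reduce_draw : forall (y : config adj) (e : edge adj) (b : bool),
      (0 < P (Y @^-1` [set y]))%E -> 0 < lam e < 1 ->
      cprob P [set t | Lam t e = b] (Y @^-1` [set y]) =
        bernoulli_pmf (lam e + (1 - lam e) * (y e)%:R) b ;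
    reduce_indep : forall (y : config adj) (A : {set edge adj})
        (z : config adj),
      (0 < P (Y @^-1` [set y]))%E ->
      (forall e, e \in A -> 0 < lam e < 1) ->
      cprob P [set t | forall e, e \in A -> Lam t e = z e]
              (Y @^-1` [set y]) =
        \prod_(e in A)
          cprob P [set t | Lam t e = z e] (Y @^-1` [set y])
  }.

(* Main.v *)
(* On an edge e with z(e) = 1 the weight lambda(e)^y(e) times the probability
   of drawing z(e) is lambda(e) whatever y(e) is; if z(e) = 0 it is
   1 - lambda(e) for y(e) = 0 and vanishes for y(e) = 1.  So P(Lambda = z) is
   an edge product times the number of even subgraphs of z.  Expanding each
   parity constraint at i as the mean of s(i)^deg(i) over a spin s(i) = 1, -1
   and summing over y first turns this number into a sum over spins of
   \prod_(z(e) = 1) (1 + s(i) s(j)), to which only the 2^#C(z) spin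
   configurations that are constant on the clusters of z contribute. *)
Require Import Defs.
From HB Require Import structures.
From mathcomp Require Import all_boot all_order all_algebra.
From mathcomp Require Import all_classical all_reals all_analysis.
From mathcomp Require Import ring lra.

Set Implicit Arguments.
Unset Strict Implicit.
Unset Printing Implicit Defensive.

Import Order.TTheory GRing.Theory Num.Theory.

Local Open Scope classical_set_scope.
Local Open Scope ring_scope.

(** * Degrees and the spin expansion of the parity constraints *)

Lemma edgeP (V : finType) (adj : rel V) (e : edge adj) :
  exists i j, adj i j /\ val e = [set i; j]%SET.
Proof.
have := valP e; case/imsetP => -[i j] /=.
by rewrite inE /= => ij ->; exists i, j.
Qed.

Lemma edge_incidentP (V : finType) (adj : rel V) (adj_sym : symmetric adj)
    (e : edge adj) (i : V) :
  i \in val e -> exists2 j, adj i j & val e = [set i; j]%SET.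
Proof.
have [k [l [kl ->]]] := edgeP e.
rewrite !inE => /orP[] /eqP ->; first by exists l.
by exists k; [rewrite adj_sym | rewrite finset.setUC].
Qed.

(** Double counting of the pairs of an edge at [i] and its other end: without loops this end exists
    and is unique, and two nodes span at most one edge. In this form, signs collected at nodes can
    be regrouped along edges. *)
Lemma degE (V : finType) (adj : rel V) (adj_sym : symmetric adj)
    (adj_irr : irreflexive adj) (y : config adj) (i : V) :
  deg i y = (\sum_(e | y e) (i \in val e))%N.
Proof.
have incE (e : edge adj) : (i \in val e) =
    (\sum_(j | (j != i) && adj i j) (val e == [set i; j]%SET))%N :> nat.
  have [ie|ie] := boolP (i \in val e); last first.
    by rewrite big1 // => j _; case: eqP ie => // ->; rewrite !inE eqxx.
  have [j ij eE] := edge_incidentP adj_sym ie.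
  have ji : j != i by apply: contraTneq ij => ->; rewrite adj_irr.
  rewrite (bigD1 j) ?ji //= eE eqxx big1 // => k /andP[/andP[ki _] kj].
  case: eqP => // /setP /(_ k).
  by rewrite !inE eqxx (negPf ki) (negPf kj).
under [RHS]eq_bigr do rewrite incE.
rewrite exchange_big; apply: eq_bigr => j _ /=.
have [/existsP[e /andP[/eqP eE ye]]|no_e] := boolP (open_edge y i j).
  rewrite (bigD1 e) //= eE eqxx big1 // => e' /andP[_ e'e].
  by case: eqP => // e'E; case/eqP: e'e; exact: val_inj (etrans e'E (esym eE)).
rewrite big1 // => e ye; case: eqP => // eE.
by case/existsP: no_e; exists e; apply/andP; split=> //; apply/eqP.
Qed.

Lemma even_indicator_sum_sign (R : numFieldType) (n : nat) :
  (~~ odd n)%:R = 2^-1 * \sum_(b : bool) (-1) ^+ (b * n) :> R.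
Proof.
rewrite big_bool /= mul1n mul0n expr0 -signr_odd.
case: (odd n); rewrite ?expr1 ?expr0; first by rewrite addNr mulr0.
by rewrite -mulr2n mulVf // pnatr_eq0.
Qed.

(** Once the spins [s] are fixed, the summand is a product over edges in which [y e] occurs in the
    factor of [e] alone, so the sum over [y] factors into a two-term sum per edge. *)
Lemma even_subgraph_sum (R : numFieldType) (V : finType) (adj : rel V)
    (adj_sym : symmetric adj) (adj_irr : irreflexive adj)
    (f : edge adj -> bool -> R) :
  \sum_(y : config adj)
     (\prod_e f e (y e)) * \prod_(i : V) (~~ odd (deg i y))%:R =
  2^-1 ^+ #|V| * \sum_(s : {ffun V -> bool})
     \prod_e (f e false + f e true * \prod_(i in val e) (-1) ^+ s i).
Proof.
pose c (s : {ffun V -> bool}) (e : edge adj) : R :=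
  \prod_(i in val e) (-1) ^+ s i.
have evenE (y : config adj) : \prod_(i : V) (~~ odd (deg i y))%:R =
    2^-1 ^+ #|V| * \sum_(s : {ffun V -> bool}) \prod_e (if y e then c s e else 1).
  under eq_bigr do rewrite even_indicator_sum_sign.
  rewrite big_split /= prodr_const; congr (_ * _).
  rewrite bigA_distr_bigA; apply: eq_bigr => s _ /=.
  (* The sign of [s i] to the power [deg i y] splits over the edges of [y] at [i]; exchanging the
     products leaves at each edge of [y] the signs of its ends. *)
  under eq_bigr do rewrite (degE adj_sym adj_irr) big_distrr /= expr_sum.
  rewrite exchange_big /= [LHS]big_mkcond; apply: eq_bigr => e _.
  case: (y e) => //; rewrite /c [RHS]big_mkcond; apply: eq_bigr => i _ /=.
  by case: (i \in val e); rewrite ?muln1 ?muln0.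
under eq_bigr do rewrite evenE mulrCA big_distrr /=.
rewrite -big_distrr /= exchange_big; congr (_ * _).
apply: eq_bigr => s _ /=.
transitivity (\prod_e \sum_(b : bool) f e b * (if b then c s e else 1)).
  rewrite bigA_distr_bigA; apply: eq_bigr => y _ /=.
  by rewrite -big_split.
by apply: eq_bigr => e _; rewrite big_bool /= mulr1 addrC.
Qed.

(** * Clusters and the spin configurations constant on them *)

Lemma open_edge_sym (V : finType) (adj : rel V) (z : config adj) :
  symmetric (open_edge z).
Proof.
by move=> i j /=; apply: eq_existsb => e; rewrite finset.setUC.
Qed.

Lemma connect_open_equiv (V : finType) (adj : rel V) (z : config adj) :
  {in [set: V]%SET & &, equivalence_rel (connect (open_edge z))}.
Proof.
move=> i j k _ _ _; split=> [|ij]; first exact: connect0.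
exact: (same_connect (sym_connect_sym (open_edge_sym z)) ij).
Qed.

Lemma pblock_clusters_eq (V : finType) (adj : rel V) (z : config adj) (i j : V) :
  (finset.pblock (clusters z) i == finset.pblock (clusters z) j) =
  connect (open_edge z) i j.
Proof.
have part := equivalence_partitionP (@connect_open_equiv _ _ z).
rewrite eq_pblock ?(partition_trivIset part) ?(cover_partition part) ?inE //.
by rewrite (pblock_equivalence_partition (@connect_open_equiv _ _ z)) ?inE.
Qed.

(** Such an [s] corresponds to the set of clusters on which it is true, and every set of clusters
    occurs. *)
Lemma card_constant_on_clusters (V : finType) (adj : rel V) (z : config adj) :
  #|[set s : {ffun V -> bool} |
      [forall i, forall j, open_edge z i j ==> (s i == s j)]]%SET| =
  (2 ^ #|clusters z|)%N.
Proof.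
have part := equivalence_partitionP (@connect_open_equiv _ _ z).
have triv := partition_trivIset part.
pose of_clusters (S : {set {set V}}) :=
  [ffun i => finset.pblock (clusters z) i \in S].
rewrite -card_powerset -(card_in_imset (f := of_clusters)); last first.
  (* Injectivity: clusters are nonempty, so the value at any node of [B] tells whether [B] was
     selected. *)
  move=> S1 S2; rewrite !inE => /fintype.subsetP S1C /fintype.subsetP S2C eqS.
  apply/setP => B; have [BC|BC] := boolP (B \in clusters z); last first.
    by rewrite (contraNF (S1C B) BC) (contraNF (S2C B) BC).
  have /set0Pn[i iB] : B != finset.set0.
    by apply: contraTneq BC => ->; case/and3P: part.
  by have /ffunP/(_ i) := eqS; rewrite !ffunE (def_pblock triv BC iB).
apply: eq_card => s; rewrite inE; apply/forallP/imsetP.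
  move=> s_inv; exists [set B in clusters z | [exists i in B, s i]]%SET.
    by rewrite inE; apply/fintype.subsetP => B; rewrite inE => /andP[].
  apply/ffunP => i; rewrite ffunE inE pblock_mem ?(cover_partition part) ?inE //=.
  have s_conn j : connect (open_edge z) i j -> s i = s j.
    (* The set where [s] is true is closed under open edges, hence under connectivity. *)
    move=> ij; have := @closed_connect _ (open_edge z) [pred k | s k] _ _ _ ij; apply.
    by move=> k l kl; have /forallP/(_ l)/implyP/(_ kl)/eqP := s_inv k.
  apply/idP/existsP => [si|[j /andP[]]].
    by exists i; rewrite mem_pblock (cover_partition part) inE.
  rewrite (pblock_equivalence_partition (@connect_open_equiv _ _ z)) ?inE //.
  by move=> /s_conn ->.
case=> S _ -> i; apply/forallP => j; apply/implyP => ij; rewrite !ffunE.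
suff /eqP -> : finset.pblock (clusters z) i == finset.pblock (clusters z) j by [].
by rewrite pblock_clusters_eq connect1.
Qed.

Lemma even_subgraph_sum_clusters (R : numFieldType) (V : finType) (adj : rel V)
    (adj_sym : symmetric adj) (adj_irr : irreflexive adj)
    (z : config adj) (lam : edge adj -> R) :
  \sum_(y : config adj)
     (\prod_e (if z e then lam e else if y e then 0 else 1 - lam e)) *
     \prod_(i : V) (~~ odd (deg i y))%:R =
  2^-1 ^+ #|V| * (\prod_(e | z e) (2 * lam e)) *
  (\prod_(e | ~~ z e) (1 - lam e)) * 2 ^+ #|clusters z|.
Proof.
rewrite (even_subgraph_sum adj_sym adj_irr
  (fun e b => if z e then lam e else if b then 0 else 1 - lam e)) -!mulrA.
congr (_ * _); rewrite mulrA.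
pose inv (s : {ffun V -> bool}) :=
  [forall i, forall j, open_edge z i j ==> (s i == s j)].
transitivity (\sum_(s | inv s)
    ((\prod_(e | z e) (2 * lam e)) * \prod_(e | ~~ z e) (1 - lam e))).
  rewrite [RHS]big_mkcond; apply: eq_bigr => s _ /=.
  rewrite (bigID (fun e => z e)) /=.
  have -> : \prod_(e | ~~ z e) ((if z e then lam e else 1 - lam e) +
      (if z e then lam e else 0) * \prod_(i in val e) (-1) ^+ s i) =
      \prod_(e | ~~ z e) (1 - lam e).
    by apply: eq_bigr => e /negPf ->; rewrite mul0r addr0.
  have pairE (e : edge adj) (i j : V) : adj i j -> val e = [set i; j]%SET ->
      \prod_(k in val e) (-1) ^+ s k = (-1) ^+ (s i (+) s j) :> R.
    move=> ij ->; have ji : i != j by apply: contraTneq ij => ->; rewrite adj_irr.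
    by rewrite big_setU1 ?big_set1 ?inE //= signr_addb.
  case: ifPn => [/forallP s_inv|/forallPn[i /forallPn[j]]].
    congr (_ * _); apply: eq_bigr => e ze; rewrite ze.
    have [i [j [ij eE]]] := edgeP e; rewrite (pairE _ _ _ ij eE).
    have zij : open_edge z i j.
      by apply/existsP; exists e; apply/andP; split=> //; apply/eqP.
    have /forallP/(_ j)/implyP/(_ zij)/eqP -> := s_inv i.
    by rewrite addbb expr0 mulr1 -mulr2n mulr_natl.
  (* An open edge with unequal spins has the factor [lam e - lam e], which kills the whole
     product. *)
  rewrite negb_imply => /andP[/existsP[e /andP[/eqP eE ze]] sij].
  have ij : adj i j.
    have [|k ik] := @edge_incidentP _ _ adj_sym e i; first by rewrite eE !inE eqxx.
    rewrite eE => /setP/(_ k); rewrite !inE eqxx orbT => /orP[]/eqP kE.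
      by rewrite kE adj_irr in ik.
    by rewrite -kE.
  rewrite (bigD1 e) //= ze (pairE _ _ _ ij eE).
  by move: sij; case: (s i); case: (s j) => //= _; rewrite expr1 mulrN1 subrr !mul0r.
rewrite sumr_const -[LHS]mulr_natr; congr (_ * _).
by rewrite -natrX -(card_constant_on_clusters z) cardsE.
Qed.

(** * Edge parameters in terms of [beta] *)

Lemma tanhe_expN2 (R : realType) (b : \bar R) : (0 <= b)%E ->
  0 <= tanhe b <= 1 /\ 1 - expN2 b = 2 * tanhe b / (1 + tanhe b).
Proof.
case: b => [r||] //.
- rewrite lee_fin => r0; rewrite /tanhe /tanh /expN2 /=.
  have -> : expR (- (2 * r)) = expR (- r) ^+ 2.
    by rewrite -expRM_natl; congr expR; ring.
  rewrite expRN; have := expR_gt0 r; have : 1 <= expR r by rewrite -expR0 ler_expR.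
  (* Both claims now concern rational functions of [u = expR r], with [u >= 1] because [r >= 0]. *)
  move: (expR r) => u u1 u0.
  have v0 : 0 < u^-1 by rewrite invr_gt0.
  have v1 : u^-1 <= 1 by rewrite invf_le1.
  split.
    by rewrite divr_ge0 ?ler_pdivrMr ?mul1r /=; lra.
  have uu : u != 0 by rewrite gt_eqF.
  by field; rewrite uu !gt_eqF //; nra.
- move=> _; rewrite /expN2 /= gt0_muley ?lte_fin //=.
  by split; [rewrite ler01 lexx | field].
Qed.

(** * The joint law of the input [Y] and the output [Lam] *)

Lemma measure_sum_fibers (R : realType) (d : measure_display)
    (T : measurableType d) (mu : {measure set T -> \bar R}) (I : finType)
    (X : T -> I) (A : set T) :
  measurable A -> (forall i, measurable (X @^-1` [set i])) ->
  mu A = (\sum_(i : I) mu (A `&` X @^-1` [set i]))%E.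
Proof.
move=> mA mX.
have {1}-> : A = \bigcup_(i in [set` index_enum I]) (A `&` X @^-1` [set i]).
  apply/seteqP; split=> [t At|t [i _ []] //].
  by exists (X t) => //=; rewrite mem_index_enum.
rewrite measure_fin_bigcup.
- by rewrite -fsbig_seq ?index_enum_uniq.
- exact: finite_finset.
- by move=> i j _ _ [t [[_ /= <-] [_ /= <-]]].
- by move=> i _; exact: measurableI.
Qed.

Lemma reduce_edge_weights_joint (R : realType) (d : measure_display)
    (T : measurableType d) (P : probability T R) (V : finType) (adj : rel V)
    (lam : edge adj -> R) (Y Lam : T -> config adj) (y z : config adj) :
  (forall e, 0 <= lam e <= 1) -> random_config Y ->
  (forall y, P (Y @^-1` [set y]) = (pi_subs lam y)%:E) ->
  reduce_edge_weights P lam Y Lam ->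
  P (Lam @^-1` [set z] `&` Y @^-1` [set y]) =
  ((Z_subs lam)^-1 *
   ((\prod_e (if z e then lam e else if y e then 0 else 1 - lam e)) *
    \prod_(i : V) (~~ odd (deg i y))%:R))%:E.
Proof.
move=> lam01 mY Y_law [mLam keep draw indep].
(* The Bernoulli kernel is used on every edge, kept ones included: its parameter is 1 if
   [lam e = 1], and [y e] if [lam e = 0], which is 0 as soon as [y] has positive probability. *)
pose K e : R := bernoulli_pmf (lam e + (1 - lam e) * (y e)%:R) (z e).
have -> : (Z_subs lam)^-1 *
    ((\prod_e (if z e then lam e else if y e then 0 else 1 - lam e)) *
     \prod_(i : V) (~~ odd (deg i y))%:R) = pi_subs lam y * \prod_e K e.
  rewrite /pi_subs /w_subs mulrAC mulrC; congr (_ * _).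
  rewrite [RHS]mulrAC; congr (_ * _).
  rewrite [X in _ = X * _]big_mkcond -big_split /=; apply: eq_bigr => e _.
  rewrite /K /bernoulli_pmf.
  by case: (y e); case: (z e) => /=; ring.
have mYy := mY y; have mLz := mLam z.
(* Conditioning on a null value of [Y] says nothing; there the joint probability is bounded by that
   of [Y = y]. *)
have [pi0|pi_neq0] := eqVneq (pi_subs lam y) 0.
  rewrite pi0 mul0r; apply/eqP; rewrite -measure_le0 -[leRHS]/(0%:E) -pi0 -Y_law.
  exact: measureIr.
have Ypos : (0 < P (Y @^-1` [set y]))%E.
  by rewrite lt_neqAle measure_ge0 andbT Y_law eqe eq_sym.
have lam1 e : ~~ (0 < lam e < 1) -> y e -> lam e = 1.
  have /andP[l0 l1] := lam01 e.
  rewrite !lt_neqAle l0 l1 !andbT negb_and !negbK => /orP[/eqP le0|/eqP //] ye.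
  case/eqP: pi_neq0; rewrite /pi_subs /w_subs (bigD1 e ye) /= -le0.
  by rewrite !mul0r.
have lamP e : ~~ (0 < lam e < 1) -> lam e = 0 \/ lam e = 1.
  have /andP[l0 l1] := lam01 e.
  rewrite !lt_neqAle l0 l1 !andbT negb_and !negbK.
  by move=> /orP[/eqP <-|/eqP ->]; [left|right].
have [/forallP kept|/forallPn[e]] :=
    boolP [forall e, (0 < lam e < 1) || ((z e)%:R == lam e)]; last first.
  (* If [z] contradicts a kept weight, the event is empty and the kernel at that edge vanishes. *)
  rewrite negb_or => /andP[eA ze].
  have -> : Lam @^-1` [set z] `&` Y @^-1` [set y] = set0.
    apply/seteqP; split=> // t [/= Lz _]; case/eqP: ze.
    by rewrite -(keep t e (lamP e eA)) Lz.
  rewrite measure0 (bigD1 e) //= [K e](_ : _ = 0) ?mul0r ?mulr0 //.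
  move: ze; rewrite /K /bernoulli_pmf; case: (z e) => /=.
    case: (lamP e eA) => le; last by rewrite le eqxx.
    case: (boolP (y e)) => ye; last by rewrite mulr0 addr0.
    by move: (lam1 e eA ye); rewrite le => /eqP; rewrite eq_sym oner_eq0.
  by case: (lamP e eA) => ->; rewrite ?eqxx //= => _; ring.
pose A := [set e | 0 < lam e < 1]%SET.
have AP e : e \in A -> 0 < lam e < 1 by rewrite inE.
have joint_fin : P (Lam @^-1` [set z] `&` Y @^-1` [set y]) \is a fin_num.
  exact/fin_num_measure/measurableI.
(* Outside [A] the output agrees with [z] surely, so only the independent draws on [A] remain. *)
have jointE : Lam @^-1` [set z] `&` Y @^-1` [set y] =
    [set t | forall e, e \in A -> Lam t e = z e] `&` Y @^-1` [set y].
  apply/seteqP; split=> t [/= Lz Yt]; split=> //; first by rewrite Lz.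
  apply/ffunP => e; have [/Lz//|] := boolP (e \in A).
  rewrite inE => eA; have := keep t e (lamP e eA).
  have := kept e; rewrite (negPf eA) /= => /eqP <- /eqP.
  by rewrite eqr_nat; case: (Lam t e); case: (z e).
have := indep y A z Ypos AP; rewrite {1}/cprob -jointE Y_law /=.
have -> : \prod_(e in A) cprob P [set t | Lam t e = z e] (Y @^-1` [set y]) =
    \prod_e K e.
  (* The kernel equals 1 on each kept edge. *)
  rewrite [RHS](bigID (fun e => e \in A)) /= [X in _ * X]big1 ?mulr1 => [|e].
    by apply: eq_bigr => e eA; rewrite draw ?AP.
  rewrite inE => eA; have := kept e; rewrite (negPf eA) /= /K /bernoulli_pmf.
  case: (z e) => /= /eqP le; first by rewrite -le; ring.
  case: (boolP (y e)) => [/(lam1 e eA)|_]; last by rewrite mulr0 addr0 -le subr0.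
  by move/eqP; rewrite -le eq_sym oner_eq0.
by move=> <-; rewrite mulrC divfK // fineK.
Qed.

(** * Matching the random-cluster normalisation *)

Lemma random_cluster_weightE (R : realType) (V : finType) (adj : rel V)
    (lam p q : edge adj -> R) (z : config adj) (Z : R) :
  (forall e, 0 <= lam e) -> (forall e, p e = 2 * lam e / (1 + lam e)) ->
  (forall e, p e = 1 - q e) ->
  Z^-1 * (2^-1 ^+ #|V| * (\prod_(e | z e) (2 * lam e)) *
    (\prod_(e | ~~ z e) (1 - lam e)) * 2 ^+ #|clusters z|) =
  (Z * 2 ^ (#|V|%:Z - #|edge adj|%:Z) * \prod_(e : edge adj) (1 + q e))^-1 *
    (\prod_(e | z e) p e) * (\prod_(e | ~~ z e) (1 - p e)) * 2 ^+ #|clusters z|.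
Proof.
move=> lam0 pE qE.
have lamD e : 1 + lam e != 0 by rewrite gt_eqF // ltr_wpDr.
(* The factors 2 produced here cancel the power of 2 with exponent [- #|edge adj|] in the
   normalisation. *)
have qlam e : 1 + q e = 2 * (1 + lam e)^-1.
  have -> : 1 + q e = 2 - p e by rewrite qE; ring.
  by rewrite pE; field.
have -> : \prod_e (1 + q e) = 2 ^+ #|edge adj| * (\prod_e (1 + lam e))^-1.
  by rewrite (eq_bigr _ (fun e _ => qlam e)) big_split /= prodr_const prodfV.
rewrite expfzDr ?pnatr_eq0 // -exprnP -exprnN.
have -> : Z * (2 ^+ #|V| * 2 ^- #|edge adj|) *
    (2 ^+ #|edge adj| * (\prod_e (1 + lam e))^-1) =
    Z * 2 ^+ #|V| * (\prod_e (1 + lam e))^-1.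
  by rewrite -!mulrA mulKf ?expf_neq0 ?pnatr_eq0.
rewrite !invfM invrK exprVn -!mulrA; do 2 congr (_ * _); rewrite !mulrA.
congr (_ * _); rewrite [\prod_e (1 + lam e)](bigID (fun e => z e)) /=.
(* One factor [1 + lam e] is assigned to each edge: it turns [p e] into [2 * lam e] and [1 - p e]
   into [1 - lam e]. *)
rewrite -!mulrA [X in _ = _ * X]mulrCA [RHS]mulrA -!big_split /=.
by congr (_ * _); apply: eq_bigr => e _; rewrite pE; field.
Qed.

Theorem theorem3 (R : realType)
  (V : finType) (adj : rel V)
  (adj_sym : symmetric adj) (adj_irr : irreflexive adj)
  (beta : edge adj -> \bar R) (beta_ge0 : forall e, (0 <= beta e)%E)
  (lam : edge adj -> R) (lamE : forall e, lam e = tanhe (beta e))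
  (p : edge adj -> R) (pE : forall e, p e = 1 - expN2 (beta e))
  (d : measure_display) (T : measurableType d) (P : probability T R)
  (Y Lam : T -> config adj)
  (Y_rv : random_config Y)
  (Y_law : forall y : config adj, P (Y @^-1` [set y]) = (pi_subs lam y)%:E)
  (Lam_alg : reduce_edge_weights P lam Y Lam)
  (Z_rc : R)
  (Z_rcE : Z_rc = Z_subs lam * 2 ^ (#|V|%:Z - #|edge adj|%:Z) *
                  \prod_(e : edge adj) (1 + expN2 (beta e))) :
  (forall e, 0 <= lam e <= 1 /\ p e = 2 * lam e / (1 + lam e)) /\
  (forall z : config adj,
     P (Lam @^-1` [set z]) =
       (Z_rc^-1 * (\prod_(e | z e) p e) * (\prod_(e | ~~ z e) (1 - p e)) *
        2 ^+ #|clusters z|)%:E).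
Proof.
have lam01_pE e : 0 <= lam e <= 1 /\ p e = 2 * lam e / (1 + lam e).
  by rewrite pE lamE; exact: tanhe_expN2.
have lam01 e := (lam01_pE e).1.
split=> // z.
(* Total probability over the values of [Y] yields the weighted sum over even subgraphs. *)
rewrite (measure_sum_fibers P (reduce_measurable Lam_alg z) Y_rv).
rewrite (eq_bigr _ (fun y _ =>
  reduce_edge_weights_joint y z lam01 Y_rv Y_law Lam_alg)).
rewrite sumEFin -big_distrr /= even_subgraph_sum_clusters // Z_rcE; congr EFin.
apply: random_cluster_weightE => // e; first by case/andP: (lam01 e).
exact: (lam01_pE e).2.
Qed.
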